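(* For every integer base $b\geq 2$, every fixed integer $j$ with $0<j<b$, and every positive integer $n$, $$\sum_{0\leq k\leq \log_b n}\left\{\frac{n+jb^k}{b^{k+1}}\right\}=\frac{1}{b-1}\left(s_b(n)-\frac{n}{b^{m+1}}\right)+(m+1)\frac{j}{b}-\lambda'_{b-j},$$ where the sum is over integers $k$, $\{\cdot\}$ denotes the fractional part, $m=\lfloor\log_b n\rfloor$ is the position of the leading digit in the $b$-ary expansion of $n$, $s_b(n)$ is the sum of the $b$-ary digits of $n$, and $\lambda'_i$ is the number of $b$-ary digits of $n$ that are greater than or equal to $i$.
   Context: The fractional part is $\{x\}=x-\lfloor x\rfloor$. The $b$-ary expansion of $n$ is $n=\sum_{s=0}^{m}c_sb^s$ with $c_s\in\{0,1,\dots,b-1\}$ and $c_m\neq 0$. Then $s_b(n)=\sum_{s=0}^{m}c_s$ and $\lambda'_i=\#\{s:0\leq s\leq m,\ c_s\geq i\}$; that is, $\lambda'=(\lambda'_1\geq\cdots\geq\lambda'_{b-1})$ is the transpose of the partition formed by the digits of $n$ in descending order. *)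

(* Defs.v *)
From mathcomp Require Import all_boot all_order all_algebra.

Set Implicit Arguments.
Unset Strict Implicit.
Unset Printing Implicit Defensive.

Import Order.TTheory GRing.Theory Num.Theory.

(* A family of m + 1 base-b digits, where [c s] is the digit at position s
   (so position 0 is the least significant one); the bound [c s < b] is carried
   by the type ['I_b]. *)
Definition digits (b m : nat) : Type := {ffun 'I_m.+1 -> 'I_b}.

Definition is_expansion (b m : nat) (c : digits b m) (n : nat) : Prop :=
  n = \sum_(s < m.+1) c s * b ^ s /\ c ord_max <> 0 :> nat.

Definition digit_sum (b m : nat) (c : digits b m) : nat := \sum_(s < m.+1) c s.

(* The i-th part of the transpose of the partition formed by the digits. *)
Definition digits_ge (b m : nat) (c : digits b m) (i : nat) : nat :=
  #|[set s : 'I_m.+1 | i <= c s]|.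

Definition frac_part (R : archiRealFieldType) (x : R) : R :=
  (x - (Num.floor x)%:~R)%R.

Lemma expansion_exists (b n : nat) :
  1 < b -> 0 < n -> exists m, exists c : digits b m, is_expansion c n.
Proof.
move=> b_gt1; have b_gt0 := ltnW b_gt1.
elim/ltn_ind: n => n IHn n_gt0; have [n_lt | n_ge] := ltnP n b.
  exists 0, [ffun=> Ordinal n_lt]; split; last first.
    by rewrite ffunE /= => n0; rewrite n0 in n_gt0.
  by rewrite big_ord1 ffunE expn0 muln1.
have [||m [c [nE c_lead]]] := IHn (n %/ b); first exact: ltn_Pdiv.
  by rewrite divn_gt0.
exists m.+1, [ffun s => if unlift ord0 s is Some t then c t
                        else Ordinal (ltn_pmod n b_gt0)].
split; last first.
  rewrite ffunE (_ : ord_max = lift ord0 ord_max); last exact: val_inj.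
  by rewrite liftK.
rewrite big_ord_recl ffunE unlift_none expn0 muln1 [LHS](divn_eq n b) addnC.
congr (_ + _); rewrite nE big_distrl; apply: eq_bigr => s _.
by rewrite ffunE liftK lift0 expnSr mulnA.
Qed.

(* Main.v *)
(* With x_k = (n mod b^k) / b^k, the k-th summand equals x_{k+1} + j/b, minus 1
   exactly when the k-th digit c_k is at least b - j.  Since
   b x_{k+1} = x_k + c_k, with x_0 = 0 and x_{m+1} = n / b^{m+1}, summing over k
   determines (b - 1) times the sum of the x_{k+1}. *)
Require Import Defs.
From mathcomp Require Import all_boot all_order all_algebra.
From mathcomp Require Import zify ring.

Import Order.TTheory GRing.Theory Num.Theory.
Local Open Scope ring_scope.

Lemma sum_digits_lt (b m : nat) (f : nat -> nat) :
  (forall s, (f s < b)%N) -> (\sum_(s < m) f s * b ^ s < b ^ m)%N.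
Proof.
move=> f_lt; elim: m => [|m IHm]; first by rewrite big_ord0.
rewrite big_ord_recr /= expnS.
apply: (@leq_trans ((f m).+1 * b ^ m)); last by rewrite leq_mul2r f_lt orbT.
by rewrite mulSn -addSn leq_add2r.
Qed.

(** Splitting off the lowest digit writes the sum as a multiple of [b] plus [f 0]; dividing by [b]
    then shifts the digit sequence. Digits are given as a function on all of [nat] so that the
    shifted sequence has the same type in the induction. *)
Lemma digit_of_expansion (b m k : nat) (f : nat -> nat) :
  (forall s, (f s < b)%N) -> (k < m)%N ->
  ((\sum_(s < m) f s * b ^ s) %/ b ^ k %% b)%N = f k.
Proof.
move=> f_lt; have b_gt0 : (0 < b)%N := leq_ltn_trans (leq0n _) (f_lt 0%N).
elim: m k f f_lt => // m IHm k f f_lt lt_km.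
have -> : (\sum_(s < m.+1) f s * b ^ s =
           (\sum_(s < m) f s.+1 * b ^ s) * b + f 0)%N.
  rewrite big_ord_recl expn0 muln1 addnC big_distrl; congr (_ + _)%N.
  by apply: eq_bigr => s _; rewrite lift0 expnSr mulnA.
case: k lt_km => [|k] lt_km; first by rewrite divn1 modnMDl modn_small.
rewrite expnS divnMA divnMDl // (divn_small (f_lt 0%N)) addn0.
exact: (IHm k (fun s => f s.+1)).
Qed.

(** This is the division of [n %% b ^ k.+1] by [b ^ k]. Divided by [b ^ k], it becomes the
    recurrence between consecutive fractions [x k] and [x k.+1]. *)
Lemma modn_expS (n b k : nat) :
  (n %% b ^ k.+1 = (n %/ b ^ k %% b) * b ^ k + n %% b ^ k)%N.
Proof.
rewrite modn_divl -expnS -(@modn_dvdm (b ^ k.+1) n (b ^ k)) ?dvdn_exp2l //.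
exact: divn_eq.
Qed.

(** Modulo [b ^ k.+1], adding [j * b ^ k] changes only the digit [ck], and [ck + j < 2 * b] allows
    at most one carry. Both corrections are added, which avoids truncated subtraction. *)
Lemma modn_add_digit (b j n k : nat) (ck := (n %/ b ^ k %% b)%N) :
  (0 < b)%N -> (j < b)%N ->
  ((n + j * b ^ k) %% b ^ k.+1 + (b - j <= ck) * b ^ k.+1 =
   n %% b ^ k.+1 + j * b ^ k)%N.
Proof.
move=> b_gt0 j_lt; have bk_gt0 : (0 < b ^ k)%N by rewrite expn_gt0 b_gt0.
rewrite -modnDml.
have := ltn_pmod n bk_gt0; have ck_lt : (ck < b)%N by rewrite ltn_pmod.
rewrite (modn_expS n) -/ck expnS; set r := (n %% _)%N; set B := (b ^ k)%N => r_lt.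
case: leqP => [le_bj | lt_bj].
  (* [e] is the digit left at position [k] after the carry. Since [e < b] and [r < B], the number
     [e * B + r] is already reduced modulo [b * B]. *)
  have [e eE] : exists e, (ck + j = b + e)%N by exists (ck + j - b)%N; lia.
  have -> : (ck * B + r + j * B = 1 * (b * B) + (e * B + r))%N by nia.
  rewrite modnMDl modn_small; first by lia.
  have : (e.+1 * B <= b * B)%N by rewrite leq_mul2r; lia.
  by rewrite mulSn; lia.
rewrite modn_small ?mul0n ?addn0 //.
have : ((ck + j).+1 * B <= b * B)%N by rewrite leq_mul2r; lia.
by rewrite mulSn mulnDl; lia.
Qed.

Lemma frac_part_natf_div (R : archiRealFieldType) (a d : nat) :
  (0 < d)%N -> frac_part (a%:R / d%:R : R) = (a %% d)%:R / d%:R.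
Proof.
move=> d_gt0; have d_gt0R : 0 < d%:R :> R by rewrite ltr0n.
have aE : a%:R / d%:R = (a %/ d)%:R + (a %% d)%:R / d%:R :> R.
  by rewrite {1}(divn_eq a d) natrD natrM mulrDl mulfK ?gt_eqF.
rewrite /frac_part (_ : Num.floor _ = (a %/ d)%:Z).
  by rewrite aE pmulrn addrAC subrr add0r.
apply: floor_def; rewrite aE intrD -pmulrn lerDl ltrD2l.
by rewrite divr_ge0 //= ltr_pdivrMr // mul1r ltr_nat ltn_pmod.
Qed.

Theorem theorem7 (R : archiRealFieldType) (b j n m : nat) (c : digits b m)
    (b_ge2 : (2 <= b)%N) (j_gt0 : (0 < j)%N) (j_ltb : (j < b)%N)
    (n_gt0 : (0 < n)%N) (c_exp : is_expansion c n) :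
  m = trunc_log b n /\
  \sum_(0 <= k < (trunc_log b n).+1)
      frac_part ((n%:R + j%:R * b%:R ^+ k) / b%:R ^+ k.+1 : R)
  = 1 / (b%:R - 1) * ((digit_sum c)%:R - n%:R / b%:R ^+ m.+1)
    + m.+1%:R * (j%:R / b%:R) - (digits_ge c (b - j)%N)%:R.
Proof.
case: c_exp => nE c_lead; have b_gt0 : (0 < b)%N := ltnW b_ge2.
(* Beyond position [m], [inord] falls back to position 0, so the bound by [b] holds everywhere; only
   the values up to [m] enter the sums. *)
pose f s := c (inord s) : nat.
have f_lt s : (f s < b)%N by apply: ltn_ord.
have fE (s : 'I_m.+1) : f s = c s by rewrite /f inord_val.
have nEf : n = (\sum_(s < m.+1) f s * b ^ s)%N.
  by rewrite nE; apply: eq_bigr => s _; rewrite fE.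
have n_lt : (n < b ^ m.+1)%N by rewrite nEf sum_digits_lt.
have mE : trunc_log b n = m.
  apply: trunc_log_eq => //; rewrite n_lt andbT nE big_ord_recr /=.
  (* The leading digit is nonzero, so the top term alone is at least [b ^ m]. *)
  apply: leq_trans (leq_addl _ _); apply: leq_pmull.
  by rewrite lt0n; apply/eqP.
split=> //; rewrite mE big_mkord.
have b_neq0 : b%:R != 0 :> R by rewrite pnatr_eq0 -lt0n.
have bX_neq0 k : b%:R ^+ k != 0 :> R by rewrite expf_neq0.
have b1_neq0 : b%:R - 1 != 0 :> R by rewrite subr_eq0 pnatr_eq1 gtn_eqF.
pose x k : R := (n %% b ^ k)%:R / b%:R ^+ k.
have digitE (s : 'I_m.+1) : (n %/ b ^ s %% b)%N = c s.
  by rewrite nEf digit_of_expansion ?fE.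
have x_step (s : 'I_m.+1) : b%:R * x s.+1 - x s = (c s)%:R.
  rewrite /x modn_expS digitE natrD natrM natrX exprS.
  by field; rewrite b_neq0 bX_neq0.
have termE (s : 'I_m.+1) :
    frac_part ((n%:R + j%:R * b%:R ^+ s) / b%:R ^+ s.+1 : R) =
    x s.+1 + j%:R / b%:R - (b - j <= c s)%N%:R.
  rewrite -!natrX -natrM -natrD frac_part_natf_div ?expn_gt0 ?b_gt0 //.
  (* Once cast to [R], the additive identity can be solved for the remainder, with the carry
     subtracted. *)
  have /(congr1 (fun a => a%:R : R)) := @modn_add_digit _ _ n s b_gt0 j_ltb.
  rewrite digitE !(natrD, natrM) => /(canRL (addrK _)) ->.
  rewrite /x !natrX exprS.
  by field; rewrite b_neq0 bX_neq0.
rewrite (eq_bigr _ (fun s _ => termE s)) sumrB big_split /=.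
rewrite sumr_const card_ord -[_ *+ m.+1]mulr_natl.
have -> : \sum_(s < m.+1) (b - j <= c s)%N%:R = (digits_ge c (b - j))%:R :> R.
  rewrite /digits_ge -sum1_card natr_sum [RHS]big_mkcond /=.
  by apply: eq_bigr => s _; rewrite inE; case: leqP.
congr (_ + _ - _).
have sumE : (b%:R - 1) * (\sum_(s < m.+1) x s.+1) =
            (digit_sum c)%:R - n%:R / b%:R ^+ m.+1.
  rewrite /digit_sum natr_sum -(eq_bigr _ (fun s _ => x_step s)) sumrB.
  have x0 : x 0%N = 0 by rewrite /x modn1 mul0r.
  have xm : x m.+1 = n%:R / b%:R ^+ m.+1 by rewrite /x modn_small.
  (* Both sides are the sum of [x] over positions 0 to [m.+1], because [x 0] vanishes; the end term
     [x m.+1] produces the correction to the digit sum. *)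
  have shift : \sum_(s < m.+1) x s + x m.+1 = \sum_(s < m.+1) x s.+1.
    rewrite -(big_mkord xpredT x) -big_nat_recr // big_nat_recl //=.
    by rewrite x0 add0r big_mkord.
  by rewrite -mulr_sumr mulrBl mul1r -xm -{2}shift opprD addrA.
by rewrite -sumE mulrA mul1r mulVf // mul1r.
Qed.
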